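(* Fix $0<\kappa<1$ and put $c(\kappa)=\min(1,\kappa^{-2}-1)$. For rings with independent holes in any compact planar pan with $\rho\le\kappa$, every descending greedy execution satisfies $$A_{\rm greedy}\ \ge\ c(\kappa)\,A_{\rm opt},$$ where $A_{\rm greedy}$ is the total area of the rings it places and $A_{\rm opt}$ is the maximum total area of a feasible set. For $\kappa\le1/\sqrt2$, the lex-max set is the unique area-optimal feasible set. For $1/\sqrt2<\kappa<1$, the constant $c(\kappa)=\kappa^{-2}-1$ is best possible even for two rings in a disk (i.e. the infimum of $A_{\rm greedy}/A_{\rm opt}$ over two-ring instances in a disk pan with $\rho\le\kappa$ equals $\kappa^{-2}-1$), and the infimum of $A_{\rm greedy}/A_{\rm opt}$ over instances with $\rho\le\kappa$ and $A_{\rm opt}>0$ is not attained.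
   Context: Model. The pan is a compact set $K\subset\mathbb R^2$. An inventory is a finite list of outer radii $r_1>r_2>\dots>r_n>0$, ring $i$ having a hole that is a disk of radius $h_i$, with $0\le h_i<r_i$ arbitrary (independent holes). The area of ring $i$ is $\pi(r_i^2-h_i^2)>0$, and the area of a set of rings is the sum of the areas of its members. A placement of a set $S$ of rings is a forest: each ring of $S$ has as parent either the pan or another ring of $S$ (whose hole radius is at least the child's outer radius), and the children of each common parent must be packable in the parent's region (the pan $K$, or the hole disk of radius $h_i$ of ring $i$), i.e. closed disks having the children's outer radii can be positioned inside that region with pairwise disjoint interiors. Feasibility depends only on the parent assignment. $S$ is feasible if it has a placement. The lex-max set $L$ is defined by scanning $i=1,\dots,n$ and including $i$ whenever $(L\cap\{1,\dots,i-1\})\cup\{i\}$ is feasible. A descending greedy execution processes the rings in decreasing outer radius; when ring $i$ is processed, a container (the pan or the hole of an already placed ring) admits it if the container's current children together with ring $i$ are packable in it (sibling positions may be rearranged); the ring receives some admitting container as its permanent parent, chosen arbitrarily, and is skipped only if no container admits it. $\rho=\max_i\bigl(\sum_{j>i}r_j\bigr)/r_i$. *)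

(* Defs.v *)
From HB Require Import structures.
From mathcomp Require Import all_boot all_order all_algebra.
From mathcomp Require Import all_classical all_reals all_analysis.

Set Implicit Arguments.
Unset Strict Implicit.
Unset Printing Implicit Defensive.

Import Order.TTheory GRing.Theory Num.Theory.
Import numFieldNormedType.Exports.

Local Open Scope ring_scope.

(* Closed Euclidean disk of the plane.  It is written out because the library
   norm on [R * R] is the sup norm; the induced topology is the same. *)
Definition cdisk (R : realType) (c : R * R) (t : R) : set (R * R) :=
  [set x | (x.1 - c.1) ^+ 2 + (x.2 - c.2) ^+ 2 <= t ^+ 2]%classic.

(* Ring number i of the text is the ordinal i - 1; positivity of the outer
   radii is a consequence of [hole_range]. *)
Record instance (R : realType) := Instance {
  pan : set (R * R);
  nrings : nat;
  outer : 'I_nrings -> R;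
  hole : 'I_nrings -> R;
  pan_compact : compact pan;
  outer_decr : forall i j : 'I_nrings, (i < j)%N -> outer j < outer i;
  hole_range : forall i : 'I_nrings, 0 <= hole i < outer i }.

Arguments outer {R} I i : rename.
Arguments hole {R} I i : rename.

Definition ring_area (R : realType) (I : instance R) (i : 'I_(nrings I)) : R :=
  pi * (outer I i ^+ 2 - hole I i ^+ 2).

Definition area (R : realType) (I : instance R) (S : {set 'I_(nrings I)}) : R :=
  \sum_(i in S) ring_area i.

(* All the quotients are nonnegative, and the one of the last ring is 0, so the
   default value 0 does not affect the maximum. *)
Definition rho (R : realType) (I : instance R) : R :=
  \big[Num.max/0]_(i < nrings I)
     ((\sum_(j < nrings I | (i < j)%N) outer I j) / outer I i).

Definition packable (R : realType) (I : instance R) (X : set (R * R))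
    (C : {set 'I_(nrings I)}) : Prop :=
  exists ctr : 'I_(nrings I) -> R * R,
    (forall i, i \in C -> cdisk (ctr i) (outer I i) `<=` X)%classic /\
    (forall i j, i \in C -> j \in C -> i != j ->
       (cdisk (ctr i) (outer I i))° `&` (cdisk (ctr j) (outer I j))°
         = set0)%classic.

(* A container is [None] (the pan) or [Some j] (the hole of ring j).  Packability
   is translation invariant, so holes are centered at the origin. *)
Definition region (R : realType) (I : instance R)
    (c : option 'I_(nrings I)) : set (R * R) :=
  if c is Some j then cdisk (0, 0) (hole I j) else pan I.

Definition children (n : nat) (S : {set 'I_n}) (p : 'I_n -> option 'I_n)
    (c : option 'I_n) : {set 'I_n} :=
  finset (fun i => (i \in S) && (p i == c)).

Definition available (n : nat) (S : {set 'I_n}) (c : option 'I_n) : Prop :=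
  if c is Some j then j \in S else True.

(* Only the values of the parent map [p] on [S] matter.  Acyclicity of the
   parent relation need not be required: outer i <= hole j < outer j makes outer
   radii strictly increase from child to parent. *)
Definition placement (R : realType) (I : instance R) (S : {set 'I_(nrings I)})
    (p : 'I_(nrings I) -> option 'I_(nrings I)) : Prop :=
  (forall i, i \in S ->
     if p i is Some j then j \in S /\ outer I i <= hole I j else True) /\
  (forall c, available S c -> packable (region c) (children S p c)).

Definition feasible (R : realType) (I : instance R)
    (S : {set 'I_(nrings I)}) : Prop :=
  exists p, placement S p.

(* The empty set is feasible and areas are nonnegative, so the default value 0
   does not affect the maximum. *)
Definition A_opt (R : realType) (I : instance R) : R :=
  \big[Num.max/0]_(S : {set 'I_(nrings I)} | `[< feasible S >]) area S.

Definition lexmax (R : realType) (I : instance R) : {set 'I_(nrings I)} :=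
  foldl (fun L i => if `[< feasible (i |: L) >] then i |: L else L)
    finset.set0 (enum 'I_(nrings I)).

Definition admits (R : realType) (I : instance R) (S : {set 'I_(nrings I)})
    (p : 'I_(nrings I) -> option 'I_(nrings I))
    (c : option 'I_(nrings I)) (i : 'I_(nrings I)) : Prop :=
  available S c /\ packable (region c) (i |: children S p c).

(* [greedy_run k S p]: some execution, after processing the k largest rings, has
   placed exactly the rings of S, with parents given by p on S. *)
Inductive greedy_run (R : realType) (I : instance R) :
    nat -> {set 'I_(nrings I)} -> ('I_(nrings I) -> option 'I_(nrings I)) ->
    Prop :=
| greedy_start : greedy_run 0%N finset.set0 (fun=> None)
| greedy_place (i : 'I_(nrings I)) S p c :
    greedy_run i S p -> admits S p c i ->
    greedy_run i.+1 (i |: S) (fun j => if j == i then c else p j)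
| greedy_skip (i : 'I_(nrings I)) S p :
    greedy_run i S p -> (forall c, ~ admits S p c i) ->
    greedy_run i.+1 S p.

Definition greedy_outcome (R : realType) (I : instance R)
    (G : {set 'I_(nrings I)}) : Prop :=
  exists p, greedy_run (nrings I) G p.

Definition cconst (R : realType) (kappa : R) : R :=
  Num.min 1 (kappa ^- 2 - 1).

(* Values of A_greedy / A_opt over the instances satisfying P and all their
   greedy executions; A_opt > 0 keeps out the meaningless ratio 0 / 0. *)
Definition greedy_ratios (R : realType) (P : instance R -> Prop) : set R :=
  [set x | exists I : instance R, exists G : {set 'I_(nrings I)},
     [/\ P I, 0 < A_opt I, greedy_outcome G & x = area G / A_opt I]]%classic.

Definition disk_pan (R : realType) (I : instance R) : Prop :=
  exists (c : R * R) (t : R), 0 < t /\ pan I = cdisk c t.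

(* Main.v *)
Require Import Defs.
From HB Require Import structures.
From mathcomp Require Import all_boot all_order all_algebra.
From mathcomp Require Import all_classical all_reals all_analysis.
From mathcomp Require Import ring lra.

(** The heart of the matter is that all greedy executions place the same set of
    rings, the lex-max set, whatever parents they choose.  Since kappa < 1, the
    outer radii of all the rings after ring k add up to less than r_k, so these
    rings fit together, side by side along a diameter, in one disk of radius r_k
    ([has_room_packable]).  Suppose that a feasible set S agrees with the greedy
    set G before ring i, and i is in S.  Follow a placement of S and the greedy
    parents ring by ring.  If they always agree up to i, the parent of i in the
    placement of S admits i, and greedy takes it.  If they first differ at
    ring k, then k could have gone to either of two containers; the one that
    greedy did not use keeps a free disk of radius r_k, where all later rings
    fit, so greedy skips nothing after k.  Either way i is in G
    ([greedy_places_first]), and G is the lex-max set ([greedy_lexmax]).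

    To compare areas, let S be feasible and different from G, and let k be the
    first ring where they differ; by the above k is in G and not in S.  If
    h_k >= kappa r_k, all the later rings fit in the hole of k, so G contains S
    and k.  If h_k < kappa r_k, then G gains the area of k, which is more than
    pi r_k^2 (1 - kappa^2), while S gains at most the later rings, whose area is
    at most pi (kappa r_k)^2.  Hence c * area S < area G for all 0 < c <= 1 with
    c kappa^2 <= 1 - kappa^2 ([greedy_area_gt]).  The bound, the uniqueness of
    the optimum (take c = 1 when kappa^2 <= 1/2), and the strict inequality
    that rules out attainment all follow from it.

    Sharpness: in a unit disk put a ring of outer radius 1 with a hole of radius
    h slightly below kappa, and a solid ring of radius kappa.  Greedy takes the
    first and must skip the second, while the second alone is feasible; the
    ratio is at most (1 - h^2) / kappa^2, which tends to kappa^-2 - 1. *)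

Set Implicit Arguments.
Unset Strict Implicit.
Unset Printing Implicit Defensive.

Import Order.TTheory GRing.Theory Num.Theory.
Import numFieldNormedType.Exports.

Local Open Scope ring_scope.

(** * Closed disks of the plane *)

Section Disks.
Variable R : realType.
Implicit Types (c d x : R * R) (r s t : R) (X : set (R * R)).

Lemma ler_norm_sqr a t : 0 <= t -> a ^+ 2 <= t ^+ 2 -> `|a| <= t.
Proof.
by move=> t0 h; rewrite -ler_sqr ?nnegrE // real_normK ?num_real.
Qed.

(** The parallelogram law applied to the two horizontal extreme points of the
    inner disk: their squared distances to [d] average to the left-hand side. *)
Lemma cdisk_subset_dist c d r t : (cdisk c r `<=` cdisk d t)%classic ->
  (c.1 - d.1) ^+ 2 + (c.2 - d.2) ^+ 2 + r ^+ 2 <= t ^+ 2.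
Proof.
move=> sub.
have := sub (c.1 + r, c.2); have := sub (c.1 - r, c.2).
rewrite /cdisk /= => hm hp.
have {}hm := hm ltac:(lra); have {}hp := hp ltac:(lra).
lra.
Qed.

Lemma cdisk_subset_radius c d r t : 0 <= t ->
  (cdisk c r `<=` cdisk d t)%classic -> r <= t.
Proof.
move=> t0 /cdisk_subset_dist h; rewrite leNgt; apply/negP => tr.
have := sqr_ge0 (c.1 - d.1); have := sqr_ge0 (c.2 - d.2); nra.
Qed.

Lemma cdisk_shift_subset d a r t : 0 <= r -> `|a| <= t - r ->
  (cdisk (d.1 + a, d.2) r `<=` cdisk d t)%classic.
Proof.
move=> r0; rewrite ler_norml => /andP[a1 a2] [u v]; rewrite /cdisk /= => h.
set w := u - (d.1 + a) in h.
have -> : u - d.1 = w + a by rewrite /w; ring.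
have v0 := sqr_ge0 (v - d.2).
have [w1 w2] : - r <= w /\ w <= r.
  by apply/andP; rewrite -ler_norml; apply: ler_norm_sqr => //; lra.
case: (leP 0 a) => a0; nra.
Qed.

Lemma continuous_sqdist c :
  continuous (fun x : R * R => (x.1 - c.1) ^+ 2 + (x.2 - c.2) ^+ 2).
Proof.
move=> x; have f1 : ((fun z : R * R => z.1 - c.1) @ x --> x.1 - c.1)%classic.
  by apply: cvgB; [exact: cvg_fst | exact: cvg_cst].
have f2 : ((fun z : R * R => z.2 - c.2) @ x --> x.2 - c.2)%classic.
  by apply: cvgB; [exact: cvg_snd | exact: cvg_cst].
exact: (cvgD (cvgM f1 f1) (cvgM f2 f2)).
Qed.

Lemma interior_cdisk c t x :
  (x.1 - c.1) ^+ 2 + (x.2 - c.2) ^+ 2 < t ^+ 2 -> ((cdisk c t)° x)%classic.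
Proof.
move=> h; have := @continuous_sqdist c x => /cvgr_lt /(_ _ h) near_x.
by rewrite /interior /=; apply: filterS near_x => y /= /ltW.
Qed.

(** From an interior point one can still move a little to the left and to the
    right inside the disk. Hence disks side by side on a horizontal line have
    disjoint interiors, even when they are tangent. *)
Lemma interior_cdisk_strip c t x : 0 <= t -> ((cdisk c t)° x)%classic ->
  c.1 - t < x.1 < c.1 + t.
Proof.
move=> t0 /nbhs_ballP[e /= e0 sub].
have push a : `|a| < e -> `|x.1 + a - c.1| <= t.
  move=> ae.
  have : (cdisk c t (x.1 + a, x.2))%classic.
    apply: sub; split; rewrite /ball /=; last by rewrite subrr normr0.
    by rewrite opprD addrA subrr sub0r normrN.
  rewrite /cdisk /= => h; apply: ler_norm_sqr => //.
  have := sqr_ge0 (x.2 - c.2); lra.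
have e2 : `|e / 2| < e by rewrite ger0_norm; lra.
have := push _ e2; have := push (- (e / 2)); rewrite normrN => /(_ e2).
rewrite !ler_norml; lra.
Qed.

Lemma cdisk_compact c t : 0 <= t -> compact (cdisk c t).
Proof.
move=> t0; pose B := (`[c.1 - t, c.1 + t] `*` `[c.2 - t, c.2 + t])%classic.
apply: (@subclosed_compact _ _ B).
- rewrite (_ : cdisk c t = (fun x : R * R => (x.1 - c.1) ^+ 2 + (x.2 - c.2) ^+ 2)
      @^-1` [set y | y <= t ^+ 2])%classic //.
  apply: closed_comp; last exact: closed_le.
  by move=> x _; exact: continuous_sqdist.
- by apply: compact_setX; exact: segment_compact.
- move=> [u v]; rewrite /cdisk /B /= !in_itv /= => h.
  have := sqr_ge0 (u - c.1); have := sqr_ge0 (v - c.2) => hv hu.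
  have [] : `|u - c.1| <= t /\ `|v - c.2| <= t.
    by split; apply: ler_norm_sqr => //; lra.
  rewrite !ler_norml; lra.
Qed.

End Disks.

(** * Packing many small disks in one disk *)

Lemma ler_sum_pred (R : numDomainType) (T : finType) (f : T -> R)
    (P Q : pred T) :
  (forall i, 0 <= f i) -> (forall i, P i -> Q i) ->
  \sum_(i | P i) f i <= \sum_(i | Q i) f i.
Proof.
move=> f0 PQ; rewrite big_mkcond [leRHS]big_mkcond; apply: ler_sum => i _.
by case: ifP => [/PQ -> //|_]; case: ifP.
Qed.

Lemma ler_sum_predD1 (R : numDomainType) (T : finType) (f : T -> R)
    (P Q : pred T) (k : T) :
  (forall i, 0 <= f i) -> (forall i, P i -> Q i) -> Q k -> ~~ P k ->
  \sum_(i | P i) f i + f k <= \sum_(i | Q i) f i.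
Proof.
move=> f0 PQ Qk Pk; rewrite [leRHS](bigD1 k) //= [leLHS]addrC; apply: lerD => //.
apply: ler_sum_pred => // i Pi; rewrite PQ //=.
by apply: contraNneq Pk => <-.
Qed.

Section Packing.
Variables (R : realType) (I : instance R).
Local Notation n := (nrings I).
Implicit Types (X : set (R * R)) (C D : {set 'I_n}) (i j k : 'I_n).

Lemma outer_gt0 i : 0 < outer I i.
Proof. by have /andP[h0 /(le_lt_trans h0)] := hole_range i. Qed.

Lemma outer_index_lt i j : outer I j < outer I i -> (i < j)%N.
Proof.
move=> ji; case: (ltngtP i j) => // [/outer_decr /(lt_trans ji)|/val_inj eij].
  by rewrite ltxx.
by rewrite eij ltxx in ji.
Qed.

Lemma packable_subset X C D : C \subset D -> packable X D -> packable X C.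
Proof.
move=> /fintype.subsetP CD [ctr [inX disj]]; exists ctr; split=> [i /CD /inX //|].
by move=> i j /CD iD /CD jD; apply: disj.
Qed.

(** A packing of [C] in [X] that leaves a disk of radius [s] free; unlike the
    outer radii of rings, [s] is arbitrary. *)
Definition has_room X C (s : R) : Prop :=
  exists (ctr : 'I_n -> R * R) (d : R * R),
    [/\ forall i, i \in C -> (cdisk (ctr i) (outer I i) `<=` X)%classic,
        forall i j, i \in C -> j \in C -> i != j ->
          ((cdisk (ctr i) (outer I i))° `&` (cdisk (ctr j) (outer I j))°
            = set0)%classic,
        (cdisk d s `<=` X)%classic
      & forall i, i \in C ->
          ((cdisk (ctr i) (outer I i))° `&` (cdisk d s)° = set0)%classic].

Lemma packable_has_room X C k : k \notin C -> packable X (k |: C) ->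
  has_room X C (outer I k).
Proof.
move=> kC [ctr [inX disj]]; exists ctr, (ctr k).
split=> [i iC|i j iC jC|| i iC].
- by apply: inX; rewrite !inE iC orbT.
- by apply: disj; rewrite !inE ?iC ?jC orbT.
- by apply: inX; rewrite !inE eqxx.
- apply: disj; rewrite ?inE ?eqxx ?iC ?orbT //.
  by apply: contraNneq kC => <-.
Qed.

Lemma cdisk_has_room d s : has_room (cdisk d s) finset.set0 s.
Proof. by exists (fun=> d), d; split=> // i; rewrite inE. Qed.

(** The rings of [D] are laid side by side, in order of index, along the
    horizontal diameter of the free disk. *)
Lemma has_room_packable X C D s : has_room X C s ->
  \sum_(i in D) outer I i <= s -> packable X (C :|: D).
Proof.
move=> [ctr [d [inX disj dX disjd]]] Ds.
have r0 i : 0 <= outer I i by exact/ltW/outer_gt0.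
(* Half the length of diameter that is taken by the rings of D before j. *)
pose off j := \sum_(i | (i \in D) && (i < j)%N) outer I i.
have off_lt i j : i \in D -> (i < j)%N -> off i + outer I i <= off j.
  move=> iD ij; apply: ler_sum_predD1; rewrite ?iD ?ltnn //.
  by move=> l /andP[-> /ltn_trans ->].
have off_le j : j \in D -> off j + outer I j <= s.
  move=> jD; apply: le_trans Ds; apply: ler_sum_predD1; rewrite ?ltnn ?andbF //.
  by move=> l /andP[].
have off_ge0 j : 0 <= off j by exact: sumr_ge0.
pose pos j : R * R := (d.1 + (off j *+ 2 + outer I j - s), d.2).
have pos_sub j : j \in D -> (cdisk (pos j) (outer I j) `<=` cdisk d s)%classic.
  move=> jD; apply: cdisk_shift_subset => //; rewrite ler_norml mulr2n.
  have := off_le _ jD; have := off_ge0 j; lra.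
have int_sub j : j \in D ->
    ((cdisk (pos j) (outer I j))° `<=` (cdisk d s)°)%classic.
  by move=> /pos_sub; exact: interiorS.
have pos_lt i j : i \in D -> (i < j)%N ->
    ((cdisk (pos i) (outer I i))° `&` (cdisk (pos j) (outer I j))°
      = set0)%classic.
  move=> iD ij; apply/seteqP; split=> // x [].
  move=> /interior_cdisk_strip /= /(_ (r0 _)) /andP[_ xi].
  move=> /interior_cdisk_strip /= /(_ (r0 _)) /andP[xj _].
  have := off_lt _ _ iD ij; rewrite !mulr2n in xi xj; lra.
exists (fun j => if j \in C then ctr j else pos j); split=> [i|i j].
  rewrite !inE; case: ifP => [iC _|_ /= iD]; first exact: inX.
  exact: subset_trans (pos_sub _ iD) dX.
rewrite !inE; case: ifP => [iC _|_ /= iD]; case: ifP => [jC _|_ /= jD] ij.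
- exact: disj.
- apply/seteqP; split=> // x [xi /(int_sub _ jD) xj].
  by rewrite -(disjd _ iC).
- apply/seteqP; split=> // x [/(int_sub _ iD) xi xj].
  by rewrite -(disjd _ jC).
- case: (ltngtP i j) => [||/val_inj eij]; first exact: pos_lt.
  + by rewrite setIC; exact: pos_lt.
  + by rewrite eij eqxx in ij.
Qed.

End Packing.

(** * Greedy executions and the lex-max set *)

Section Greedy.
Variables (R : realType) (I : instance R).
Local Notation n := (nrings I).
Implicit Types (S G : {set 'I_n}) (p q : 'I_n -> option 'I_n).
Implicit Types (c : option 'I_n) (i j k : 'I_n).

Definition below S (k : nat) : {set 'I_n} :=
  finset (fun i => (i \in S) && (i < k)%N).

Lemma below_idP S (k : nat) : (forall i, i \in S -> (i < k)%N) -> below S k = S.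
Proof.
by move=> Sk; apply/setP => i; rewrite inE; case iS: (i \in S); rewrite // Sk.
Qed.

Lemma eq_children S p q c :
  (forall i, i \in S -> p i = q i) -> children S p c = children S q c.
Proof.
by move=> pq; apply/setP => i; rewrite !inE; case iS: (i \in S); rewrite //= pq.
Qed.

Lemma eq_admits S p q c i : (forall j, j \in S -> p j = q j) ->
  admits S p c i -> admits S q c i.
Proof. by move=> /eq_children pq [av pk]; split=> //; rewrite -pq. Qed.

Lemma children_subset S S' p c : S \subset S' ->
  children S p c \subset children S' p c.
Proof.
move=> /fintype.subsetP sub; apply/fintype.subsetP => i; rewrite !inE.
by move=> /andP[/sub -> ->].
Qed.

Lemma placement_parent S p i j : placement S p -> i \in S -> p i = Some j ->
  j \in S /\ (j < i)%N.
Proof.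
move=> [par _] /par; move=> + pij; rewrite pij => -[jS ij]; split=> //.
apply: outer_index_lt; apply: le_lt_trans ij _.
by have /andP[] := hole_range j.
Qed.

Lemma placement_below S p (k : nat) : placement S p -> placement (below S k) p.
Proof.
move=> pl; have [par pk] := pl; split=> [i|c av].
  rewrite inE => /andP[iS ik]; have := par _ iS; case pij: (p i) => [j|] //.
  move=> [jS ->]; split=> //; rewrite inE jS.
  by have [_ /ltn_trans ->] := placement_parent pl iS pij.
apply: (@packable_subset _ _ _ _ (children S p c)).
  by apply: children_subset; apply/fintype.subsetP => i; rewrite inE => /andP[].
by apply: pk; case: c av => [j|//] /=; rewrite inE => /andP[].
Qed.

Lemma packable_set0 (X : set (R * R)) : packable (I := I) X finset.set0.
Proof. by exists (fun=> (0, 0)); split=> [i|i j]; rewrite inE. Qed.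

Lemma children_new S p i : placement S p -> i \notin S ->
  children S p (Some i) = finset.set0.
Proof.
move=> pl iS; apply/setP => j; rewrite !inE; apply/negP => /andP[jS /eqP pj].
by have [] := placement_parent pl jS pj; rewrite (negbTE iS).
Qed.

(** What is left of an execution when its history is forgotten: the state in
    which ring [i] was examined is recovered as [below G i], because parents
    are permanent. *)
Definition greedy_placement (k : nat) G p : Prop :=
  [/\ forall i, i \in G -> (i < k)%N, placement G p
    & forall i, (i < k)%N -> i \notin G ->
        forall c, ~ admits (below G i) p c i].

Lemma admits_hole_ge S p i j : admits S p (Some j) i -> outer I i <= hole I j.
Proof.
move=> [_ [ctr [/(_ i) inX _]]].
have /andP[h0 _] := hole_range j.
by apply: cdisk_subset_radius h0 (inX _); rewrite !inE eqxx.
Qed.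

Lemma greedy_run_placement (k : nat) G p :
  greedy_run k G p -> greedy_placement k G p.
Proof.
elim=> [|i S {}p c _ [Si pl skip] adm|i S {}p _ [Si pl skip] nadm].
- split=> [i||//]; rewrite ?inE //; split=> [i|c _]; rewrite ?inE //.
  rewrite (_ : children _ _ _ = finset.set0); first exact: packable_set0.
  by apply/setP => i; rewrite !inE.
- have iS : i \notin S by apply/negP => /Si; rewrite ltnn.
  have parc : if c is Some l then l \in S /\ outer I i <= hole I l else True.
    case: c adm => [l|//] adm; split; first by case: adm.
    exact: admits_hole_ge adm.
  set p' := fun j => _.
  have p'E j : j \in S -> p' j = p j.
    by move=> jS; rewrite /p' ifN //; apply: contraNneq iS => <-.
  split=> [j||l].
  + by rewrite !inE => /orP[/eqP -> //|/Si /ltnW].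
  + have [par pk] := pl; split=> [j|c' av].
      rewrite !inE => /orP[/eqP ->|jS].
        rewrite /p' eqxx; move: parc; case: (c) => [l|//] [lS ->].
        by rewrite !inE lS orbT.
      rewrite p'E //; have := par _ jS; case: (p j) => [l|//] [lS ->].
      by rewrite !inE lS orbT.
    have chE : children (i |: S) p' c' =
        if c' == c then i |: children S p c else children S p c'.
      apply/setP => j; rewrite [RHS](fun_if (fun A : {set 'I_n} => j \in A)) !inE.
      have [->|ji] := eqVneq j i; rewrite /p'.
        by rewrite eqxx /= (negbTE iS) /= eq_sym; case: (c' == c).
      by rewrite (negbTE ji) /=; case: (eqVneq c' c) => // ->.
    rewrite chE; case: eqVneq => [->|c'c]; first exact: adm.2.
    case: c' av {chE c'c} => [l|_]; last exact: pk.
    rewrite /= !inE => /orP[/eqP ->|lS]; last exact: pk.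
    by rewrite children_new //; exact: packable_set0.
  + rewrite ltnS leq_eqVlt !inE negb_or => /orP[/eqP/val_inj ->|li].
      by rewrite eqxx.
    move=> /andP[_ lS] c'.
    have -> : below (i |: S) l = below S l.
      apply/setP => j; rewrite !inE; have [->|//] := eqVneq j i.
      by rewrite (ltnNge i) (ltnW li) !andbF.
    move=> /(@eq_admits _ _ p) adm'; apply: (skip l li lS c'); apply: adm'.
    by move=> j; rewrite inE => /andP[/p'E].
- split=> [j /Si /ltnW//||l] //.
  rewrite ltnS leq_eqVlt => /orP[/eqP/val_inj ->|li]; last exact: skip.
  by rewrite below_idP.
Qed.

Lemma greedy_run_exists (k : nat) : (k <= n)%N ->
  exists S p, greedy_run (I := I) k S p.
Proof.
elim: k => [_|k IH kn]; first by exists finset.set0, (fun=> None); constructor.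
have [S [p run]] := IH (ltnW kn); pose i := Ordinal kn.
have [[c adm]|nadm] := pselect (exists c, admits S p c i).
  by exists (i |: S), (fun j => if j == i then c else p j); exact: (@greedy_place _ _ i).
exists S, p; apply: (@greedy_skip _ _ i) => // c adm.
by apply: nadm; exists c.
Qed.

Lemma greedy_outcome_exists : exists G, greedy_outcome (I := I) G.
Proof. by have [S [p run]] := greedy_run_exists (leqnn n); exists S, p. Qed.

Hypothesis tail_le : forall i, \sum_(j < n | (i < j)%N) outer I j <= outer I i.

(** The free disk left in [c] just after ring [k] can accommodate the later
    rings all at once, hence whichever of them greedy has put in [c] together
    with the one being examined; so nothing is skipped. *)
Lemma greedy_places_rest G p k c s :
  greedy_placement n G p -> available (below G k.+1) c ->
  has_room (region c) (children (below G k.+1) p c) s ->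
  \sum_(j < n | (k < j)%N) outer I j <= s ->
  forall j, (k < j)%N -> j \in G.
Proof.
move=> [_ pl skip] av room le_s j kj; apply/negPn/negP => jG.
apply: (skip j (ltn_ord j) jG c); split.
  case: c av {room} => [l|//] /=; rewrite !inE => /andP[-> lk].
  exact: leq_trans lk kj.
pose D : {set 'I_n} := finset (fun i => (k < i)%N).
have pkD : packable (region c) (children (below G k.+1) p c :|: D).
  apply: has_room_packable room _; rewrite (eq_bigl (fun i => (k < i)%N)) //.
  by move=> i; rewrite inE.
apply: packable_subset pkD; apply/fintype.subsetP => i; rewrite !inE.
move=> /orP[/eqP ->|]; first by rewrite kj orbT.
by move=> /andP[/andP[-> _] ->]; rewrite ltnS andbT; case: leqP.
Qed.

(** The exchange argument: where a placement of [S] departs from the greedy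
    parents, greedy had two admitting containers, and the one it left unused
    keeps room for all later rings. *)
Lemma greedy_places_first G p S i :
  greedy_placement n G p -> feasible S -> below S i = below G i ->
  i \in S -> i \in G.
Proof.
move=> gr [q plS] SG iS; apply/negPn/negP => iG.
have [_ plG skip] := gr.
have eqSG (l : 'I_n) : (l < i)%N -> (l \in S) = (l \in G).
  by move=> li; have /setP/(_ l) := SG; rewrite !inE li !andbT.
(* As long as the two placements agree before k, each container has the same
   children in both, so the parent of k in S admits k in the greedy state. *)
have qadm (k : 'I_n) : k \in S -> (k <= i)%N ->
    (forall l : 'I_n, l \in G -> (l < k)%N -> p l = q l) ->
    admits (below G k) p (q k) k.
  move=> kS ki pq.
  have belowE : below G k = below S k.
    apply/setP => l; rewrite !inE; case: ltnP => lk; rewrite ?andbF //.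
    by rewrite eqSG // (leq_trans lk ki).
  split.
    case qk: (q k) => [l|//] /=.
    have [lS lk] := placement_parent plS kS qk.
    by rewrite belowE inE lS lk.
  apply: (@packable_subset _ _ _ _ (children S q (q k))).
    apply/fintype.subsetP => l; rewrite !inE => /orP[/eqP ->|].
      by rewrite kS eqxx.
    move=> /andP[/andP[lG lk]] /eqP pl.
    by rewrite eqSG ?(leq_trans lk ki) // lG -pl pq //=.
  apply: plS.2; case qk: (q k) => [l|//] /=.
  by have [] := placement_parent plS kS qk.
have pq (k : 'I_n) : k \in G -> (k < i)%N -> p k = q k.
  (* Strong induction on k: a first disagreement at k would force i into G. *)
  have [m] := ubnP k; elim: m k => // m IH k km kG ki.
  have kS : k \in S by rewrite eqSG.
  have [av pk] : admits (below G k) p (q k) k.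
    apply: qadm => // [|l lG lk]; first exact: ltnW.
    by apply: IH => //; [exact: leq_trans lk km | exact: ltn_trans lk ki].
  apply/eqP/negPn/negP => pqk.
  have kch : k \notin children (below G k) p (q k) by rewrite !inE ltnn !andbF.
  have room := packable_has_room kch pk.
  suff /(_ i ki) : forall j, (k < j)%N -> j \in G by rewrite (negbTE iG).
  apply: (greedy_places_rest gr (c := q k) _ _ (tail_le k)).
    case: (q k) av => [l|//] /=; rewrite !inE => /andP[-> lk].
    exact: ltnW.
  rewrite (_ : children _ _ _ = children (below G k) p (q k)) //.
  apply/setP => l; rewrite !inE ltnS leq_eqVlt.
  have [->|lk] := eqVneq l k; first by rewrite (negbTE pqk) !andbF.
  by rewrite (_ : (l == k :> nat) = false) //; apply: negbTE.
apply: (skip i (ltn_ord i) iG (q i)).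
by apply: qadm => // l lG li; exact: pq.
Qed.

Lemma greedy_lexmax G : greedy_outcome G -> G = lexmax I.
Proof.
move=> [p /greedy_run_placement gr]; have [_ pl _] := gr.
suff H (m : nat) : (m <= n)%N ->
    below G m = foldl (fun L i => if `[< feasible (i |: L) >] then i |: L else L)
                  finset.set0 (take m (enum 'I_n)).
  by rewrite /lexmax -[enum _]take_size size_enum_ord -H // below_idP.
elim: m => [_|m IH mn]; first by rewrite take0; apply/setP => i; rewrite !inE andbF.
pose i := Ordinal mn.
rewrite (take_nth i) ?size_enum_ord // foldl_rcons -IH ?(ltnW mn) //.
rewrite (_ : nth i (enum 'I_n) m = i); last exact: (nth_ord_enum i i).
have bE : below G m.+1 = if i \in G then i |: below G m else below G m.
  apply/setP => l; rewrite [RHS](fun_if (fun A : {set 'I_n} => l \in A)) !inE.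
  rewrite ltnS leq_eqVlt.
  have [->|li] := eqVneq l i; first by rewrite eqxx /= ltnn andbF andbT; case: (i \in G).
  rewrite (_ : (l == m :> nat) = false) /= ?if_same //.
  by apply: negbTE; apply: contraNneq li => lm; apply/eqP/val_inj.
rewrite bE; case: asboolP => [feas|nfeas].
  rewrite (greedy_places_first gr feas (i := i)) ?inE ?eqxx //.
  apply/setP => l; rewrite !inE; have [->|_ /=] := eqVneq l i; rewrite /= ?ltnn ?andbF //.
  by rewrite -andbA andbb.
case: ifP => // iG; case: nfeas; rewrite iG in bE.
by rewrite -bE; exists p; exact: placement_below.
Qed.

End Greedy.

(** * Comparing areas *)

Lemma rho_tail (R : realType) (kappa : R) (I : instance R) :
  rho I <= kappa -> forall i : 'I_(nrings I),
  \sum_(j < nrings I | (i < j)%N) outer I j <= kappa * outer I i.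
Proof.
move=> le_rho i; rewrite -ler_pdivrMr ?outer_gt0 //; apply: le_trans le_rho.
exact: (le_bigmax _ (fun i : 'I_(nrings I) =>
  (\sum_(j < nrings I | (i < j)%N) outer I j) / outer I i)).
Qed.

Section AreaComparison.
Variables (R : realType) (kappa : R).
Hypotheses (kappa_gt0 : 0 < kappa) (kappa_lt1 : kappa < 1).
Variable I : instance R.
Hypothesis le_rho : rho I <= kappa.
Local Notation n := (nrings I).
Implicit Types (S G : {set 'I_n}) (i j k : 'I_n).

Lemma tail_le_outer i : \sum_(j < n | (i < j)%N) outer I j <= outer I i.
Proof.
apply: le_trans (rho_tail le_rho i) _.
by rewrite ler_piMl ?ltW // outer_gt0.
Qed.

Lemma ring_area_gt0 i : 0 < ring_area i.
Proof.
apply: mulr_gt0; first exact: pi_gt0.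
have /andP[h0 hr] := hole_range i; nra.
Qed.

Lemma ring_area_ge0 i : 0 <= ring_area i.
Proof. exact/ltW/ring_area_gt0. Qed.

Lemma area_ge0 S : 0 <= area S.
Proof. by apply: sumr_ge0 => i _; exact: ring_area_ge0. Qed.

(** Each later ring has radius at most kappa r_k, so the sum of the squares of
    the radii is at most kappa r_k times their sum. *)
Lemma tail_area_le k :
  \sum_(j < n | (k < j)%N) ring_area j <= pi * (kappa * outer I k) ^+ 2.
Proof.
have tail := rho_tail le_rho k; have r0 i := ltW (outer_gt0 i).
have kr0 : 0 <= kappa * outer I k by rewrite mulr_ge0 // ltW.
have pi0 : 0 <= pi :> R by exact: pi_ge0.
apply: (@le_trans _ _
    (\sum_(j < n | (k < j)%N) pi * (kappa * outer I k * outer I j))).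
  apply: ler_sum => j kj; apply: ler_wpM2l => //.
  have rj : outer I j <= kappa * outer I k.
    apply: le_trans tail; rewrite (bigD1 j) //= lerDl; exact: sumr_ge0.
  have /andP[h0 _] := hole_range j; have := outer_gt0 j; nra.
by rewrite -mulr_sumr; apply: ler_wpM2l => //; rewrite -mulr_sumr expr2; apply: ler_wpM2l.
Qed.

Lemma first_difference G S : greedy_outcome G -> feasible S -> S <> G ->
  exists k, [/\ k \in G, k \notin S & below S k = below G k].
Proof.
move=> [p /greedy_run_placement gr] feas SG.
have [i0 di0] : exists i, (i \in S) != (i \in G).
  apply/existsP; apply: contra_notT SG => /existsPn SG.
  by apply/setP => i; apply/eqP/negPn/SG.
case: (@arg_minnP _ i0 (fun i => (i \in S) != (i \in G)) val di0) => k dk mink.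
have bk : below S k = below G k.
  apply/setP => l; rewrite !inE; case: ltnP => lk; rewrite ?andbF // !andbT.
  by apply/eqP/negPn/negP => /mink; rewrite leqNgt lk.
exists k; case kS: (k \in S) dk; last by case: (k \in G).
by rewrite (greedy_places_first tail_le_outer gr feas bk kS).
Qed.

(** Strictness holds in both cases of the proof; this single inequality gives
    the bound, the uniqueness of the optimum and the non-attainment. *)
Lemma greedy_area_gt (c : R) G S : 0 < c <= 1 -> c * kappa ^+ 2 <= 1 - kappa ^+ 2 ->
  greedy_outcome G -> feasible S -> S <> G -> c * area S < area G.
Proof.
move=> /andP[c0 c1] ck out feas SG.
have [k [kG kS bk]] := first_difference out feas SG.
have S0 := area_ge0 S.
(* In the wide case every ring after k fits in the hole of k; in the narrow
   case the area of k alone exceeds c times that of all the later rings. *)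
have [wide|narrow] := leP (kappa * outer I k) (hole I k).
  have [p /greedy_run_placement gr] := out; have [_ pl _] := gr.
  have rest : forall j, (k < j)%N -> j \in G.
    apply: (greedy_places_rest (c := Some k) gr _ _ (le_trans (rho_tail le_rho k) wide)).
      by rewrite /= inE kG /=.
    rewrite (_ : children _ _ _ = finset.set0); first exact: cdisk_has_room.
    apply/setP => j; rewrite !inE ltnS; apply/negP => /andP[/andP[jG jk]] /eqP pj.
    by have [_] := placement_parent pl jG pj; rewrite ltnNge jk.
  have : area S + ring_area k <= area G.
    apply: ler_sum_predD1 => //; first exact: ring_area_ge0.
    move=> i iS; have [ik|/rest//|/val_inj ik] := ltngtP i k.
      by have /setP/(_ i) := bk; rewrite !inE iS ik /= andbT => <-.
    by rewrite -ik iS in kS.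
  have := ring_area_gt0 k; nra.
pose common := \sum_(i in below G k) ring_area i.
have areaG : common + ring_area k <= area G.
  apply: ler_sum_predD1 => //; first exact: ring_area_ge0.
    by move=> i; rewrite inE => /andP[].
  by rewrite inE ltnn andbF.
have areaS : area S <= common + pi * (kappa * outer I k) ^+ 2.
  apply: le_trans (lerD (lexx _) (tail_area_le k)).
  rewrite /area (bigID (fun i : 'I_n => (i < k)%N)) /=; apply: lerD.
    by rewrite /common -bk; apply: ler_sum_pred => [|i iS];
      [exact: ring_area_ge0 | rewrite inE].
  apply: ler_sum_pred => [|i /andP[iS]]; first exact: ring_area_ge0.
  rewrite -leqNgt leq_eqVlt => /orP[/eqP/val_inj ki|//].
  by rewrite ki iS in kS.
have common0 : 0 <= common by apply: sumr_ge0 => i _; exact: ring_area_ge0.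
have areak : pi * outer I k ^+ 2 * (1 - kappa ^+ 2) < ring_area k.
  rewrite /ring_area -mulrA ltr_pM2l ?pi_gt0 //.
  have /andP[h0 _] := hole_range k; nra.
have prk : 0 <= pi * outer I k ^+ 2 :> R by rewrite mulr_ge0 ?pi_ge0 ?sqr_ge0.
have : c * (pi * (kappa * outer I k) ^+ 2) <= pi * outer I k ^+ 2 * (1 - kappa ^+ 2).
  by have := ler_wpM2l prk ck; rewrite exprMn; lra.
have : c * area S <= common + c * (pi * (kappa * outer I k) ^+ 2) by nra.
lra.
Qed.

Lemma greedy_feasible G : greedy_outcome G -> feasible G.
Proof. by move=> [p /greedy_run_placement[_ pl _]]; exists p. Qed.

Lemma area_le_A_opt S : feasible S -> area S <= A_opt I.
Proof.
by move=> feas; apply: (le_bigmax_cond _ (fun S => area S)); apply/asboolP.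
Qed.

Lemma A_opt_le (x : R) : 0 <= x -> (forall S, feasible S -> area S <= x) ->
  A_opt I <= x.
Proof. by move=> x0 H; apply: bigmax_le => // S /asboolP /H. Qed.

Lemma greedy_ratio_ge (c : R) G : 0 < c <= 1 -> c * kappa ^+ 2 <= 1 - kappa ^+ 2 ->
  greedy_outcome G -> c * A_opt I <= area G.
Proof.
move=> c01 ck out; have /andP[c0 c1] := c01.
rewrite mulrC -ler_pdivlMr //; apply: A_opt_le => [|S feas].
  by rewrite divr_ge0 ?area_ge0 // ltW.
rewrite ler_pdivlMr // mulrC; have [->|/eqP SG] := eqVneq S G.
  by rewrite ler_piMl ?area_ge0.
exact/ltW/(greedy_area_gt c01).
Qed.

Lemma greedy_ratio_gt (c : R) G : 0 < c < 1 -> c * kappa ^+ 2 <= 1 - kappa ^+ 2 ->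
  greedy_outcome G -> 0 < A_opt I -> c * A_opt I < area G.
Proof.
move=> /andP[c0 c1] ck out opt0.
have c01 : 0 < c <= 1 by rewrite c0 ltW.
have G0 : 0 < area G.
  by apply: lt_le_trans (greedy_ratio_ge c01 ck out); rewrite mulr_gt0.
rewrite mulrC -ltr_pdivlMr //; apply: bigmax_lt => [|S /asboolP feas].
  by rewrite divr_gt0.
rewrite ltr_pdivlMr // mulrC; have [->|/eqP SG] := eqVneq S G.
  by rewrite gtr_pMl.
exact: greedy_area_gt.
Qed.

End AreaComparison.

(** * Two rings in a disk *)

Section TwoRings.
Variables (R : realType) (kappa h : R).
Hypotheses (kappa_gt0 : 0 < kappa) (kappa_lt1 : kappa < 1).
Hypotheses (h_ge0 : 0 <= h) (h_lt : h < kappa).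

Definition two_outer (i : 'I_2) : R := if val i == 0%N then 1 else kappa.
Definition two_hole (i : 'I_2) : R := if val i == 0%N then h else 0.

Lemma two_outer_decr (i j : 'I_2) : (i < j)%N -> two_outer j < two_outer i.
Proof. by have := kappa_lt1; case: i j => [[|[|i]] ?] [[|[|j]] ?]. Qed.

Lemma two_hole_range (i : 'I_2) : 0 <= two_hole i < two_outer i.
Proof.
have k0 := kappa_gt0; have k1 := kappa_lt1; have h0 := h_ge0; have hk := h_lt.
rewrite /two_hole /two_outer; case: (val i == 0%N); apply/andP; split; lra.
Qed.

Definition two_rings : instance R :=
  Instance (@cdisk_compact R (0, 0) 1 ler01) two_outer_decr two_hole_range.

Local Definition big_ring : 'I_(nrings two_rings) := @Ordinal 2 0 isT.
Local Definition small_ring : 'I_(nrings two_rings) := @Ordinal 2 1 isT.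

Lemma two_rings_rho : rho two_rings <= kappa.
Proof.
have k0 := kappa_gt0; have k1 := kappa_lt1.
apply: bigmax_le => [|i _]; first exact: ltW.
rewrite ler_pdivrMr ?outer_gt0 //= big_mkcond /= !big_ord_recl big_ord0 /=.
rewrite /two_outer; case: i => [[|[|i]] ?] //=; rewrite ?mulr1; nra.
Qed.

(** The large ring fills the pan, so its center is the origin, and the center of
    the small ring is interior to both disks. *)
Lemma two_rings_not_both :
  ~ packable (pan two_rings) (small_ring |: (big_ring |: finset.set0)).
Proof.
have k0 := kappa_gt0; have k1 := kappa_lt1.
move=> [ctr [inX disj]].
have b : big_ring \in small_ring |: (big_ring |: finset.set0) by rewrite !inE.
have s : small_ring \in small_ring |: (big_ring |: finset.set0) by rewrite !inE.
have /= := cdisk_subset_dist (inX _ b); have /= := cdisk_subset_dist (inX _ s).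
rewrite /two_outer /= !subr0 !expr1n => ds db.
have := sqr_ge0 (ctr big_ring).1; have := sqr_ge0 (ctr big_ring).2 => y0 x0.
have cb1 : (ctr big_ring).1 = 0 by apply/eqP; rewrite -sqrf_eq0; apply/eqP; lra.
have cb2 : (ctr big_ring).2 = 0 by apply/eqP; rewrite -sqrf_eq0; apply/eqP; lra.
have k2 : 0 < kappa ^+ 2 by rewrite exprn_gt0.
have /seteqP[/(_ (ctr small_ring)) + _] := disj _ _ b s isT.
apply; split; apply: interior_cdisk; rewrite /= /two_outer /=.
  by rewrite cb1 cb2 !subr0 expr1n; lra.
by rewrite !subrr expr0n /=; lra.
Qed.

Lemma two_rings_greedy :
  greedy_outcome (I := two_rings) (big_ring |: finset.set0).
Proof.
have hk := h_lt.
exists (fun j => if j == big_ring then None else None).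
have run1 : greedy_run (I := two_rings) 1 (big_ring |: finset.set0)
    (fun j => if j == big_ring then None else None).
  apply: (@greedy_place _ _ big_ring); first exact: greedy_start.
  split=> //; exists (fun=> (0, 0)); split=> [i|i j].
    by rewrite !inE orbF => /eqP ->.
  by rewrite !inE !orbF => /eqP -> /eqP ->; rewrite eqxx.
apply: (@greedy_skip _ two_rings small_ring) => // -[l|] adm.
  have [/= + _] := adm; rewrite !inE orbF => /eqP le0.
  by have := admits_hole_ge adm; rewrite le0 /= /two_hole /two_outer /=; lra.
have [_ /=] := adm; apply/contra_not: two_rings_not_both.
apply: packable_subset; apply/fintype.subsetP => i; rewrite !inE !orbF.
by move=> /orP[->//|/eqP ->]; rewrite eqxx orbT.
Qed.

Lemma two_rings_small_feasible :
  feasible (I := two_rings) (small_ring |: finset.set0).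
Proof.
have k0 := kappa_gt0; have k1 := kappa_lt1.
exists (fun=> None); split=> // -[l|] _.
  rewrite (_ : children _ _ _ = finset.set0); first exact: packable_set0.
  by apply/setP => i; rewrite !inE andbF.
exists (fun=> (0, 0)); split=> [i|i j].
  rewrite !inE orbF andbT => /eqP ->; rewrite /= /two_outer /= => -[x y].
  by rewrite /cdisk /= expr1n => H; nra.
by rewrite !inE !orbF !andbT => /eqP -> /eqP ->; rewrite eqxx.
Qed.

(** The small ring alone is feasible, so its area bounds the optimum from below
    and the ratio from above. *)
Lemma two_rings_ratio :
  greedy_ratios (fun I : instance R =>
      [/\ nrings I = 2%N, disk_pan I & rho I <= kappa])
    (area (big_ring |: finset.set0) / A_opt two_rings) /\
  area (big_ring |: finset.set0) / A_opt two_rings <= (1 - h ^+ 2) / kappa ^+ 2.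
Proof.
have k1 := kappa_lt1; have h0 := h_ge0; have hk := h_lt.
have areaU1 i : area (i |: finset.set0) = ring_area (i : 'I_(nrings two_rings)).
  by rewrite /area finset.setU0 big_set1.
have opt : pi * kappa ^+ 2 <= A_opt two_rings.
  have := area_le_A_opt two_rings_small_feasible.
  by rewrite areaU1 /ring_area /= /two_outer /two_hole /= expr0n subr0.
have k2 : 0 < kappa ^+ 2 by rewrite exprn_gt0.
have opt0 : 0 < A_opt two_rings by apply: lt_le_trans opt; rewrite mulr_gt0 ?pi_gt0.
split.
  exists two_rings, (big_ring |: finset.set0); split=> //; last exact: two_rings_greedy.
  by split=> //; [exists (0, 0), 1 | exact: two_rings_rho].
rewrite areaU1 /ring_area /= /two_outer /two_hole /= expr1n.
rewrite ler_pdivrMr // mulrAC ler_pdivlMr //.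
have : 0 <= 1 - h ^+ 2 by nra.
move=> /ler_wpM2l /(_ _ _ opt); lra.
Qed.

End TwoRings.

Lemma greedy_ratios_lt (R : realType) (kappa x : R) :
  0 < kappa < 1 -> kappa ^- 2 - 1 < x ->
  exists2 y, greedy_ratios (fun I : instance R =>
      [/\ nrings I = 2%N, disk_pan I & rho I <= kappa]) y & y < x.
Proof.
move=> /andP[k0 k1] cx.
(* The hole has radius kappa - e, and (1 - (kappa - e)^2) / kappa^2 exceeds
   kappa^-2 - 1 by at most 2 e / kappa, hence by at most half of the distance
   to x; e <= kappa / 2 keeps the hole radius nonnegative. *)
pose e := Num.min (kappa / 2) ((x - (kappa ^- 2 - 1)) * kappa / 4).
have k2 : 0 < kappa ^+ 2 by rewrite exprn_gt0.
have e0 : 0 < e by rewrite /e lt_min !divr_gt0 // mulr_gt0 // subr_gt0.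
have e1 : e <= kappa / 2 by rewrite /e ge_min lexx.
have e2 : e <= (x - (kappa ^- 2 - 1)) * kappa / 4 by rewrite /e ge_min lexx orbT.
have h0 : 0 <= kappa - e by lra.
have hk : kappa - e < kappa by lra.
have [E le_y] := two_rings_ratio k0 k1 h0 hk.
eexists; first exact: E.
apply: le_lt_trans le_y _; rewrite ltr_pdivrMr //.
have kk : kappa ^- 2 * kappa ^+ 2 = 1 by rewrite mulVf // gt_eqF.
set u := x - _ in e2.
have -> : x = u + kappa ^- 2 - 1 by rewrite /u; ring.
have u0 : 0 < u by rewrite subr_gt0.
have : e * kappa <= u * kappa ^+ 2 / 4 by nra.
have -> : (u + kappa ^- 2 - 1) * kappa ^+ 2 = u * kappa ^+ 2 + 1 - kappa ^+ 2.
  by rewrite mulrBl mulrDl kk mul1r.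
move: e0 e1; clearbody e u; nra.
Qed.

(** * The approximation ratio of greedy *)

Theorem theorem42 (R : realType) (kappa : R) (kappa_gt0 : 0 < kappa)
    (kappa_lt1 : kappa < 1) :
  [/\ forall I : instance R, rho I <= kappa ->
        forall G : {set 'I_(nrings I)}, greedy_outcome G ->
          area G >= cconst kappa * A_opt I,
      kappa <= (Num.sqrt 2)^-1 ->
        forall I : instance R, rho I <= kappa ->
          forall S : {set 'I_(nrings I)},
            (feasible S /\ area S = A_opt I) <-> S = lexmax I,
      (Num.sqrt 2)^-1 < kappa ->
        inf (greedy_ratios (fun I : instance R =>
               [/\ nrings I = 2%N, disk_pan I & rho I <= kappa]))
        = kappa ^- 2 - 1
    & (Num.sqrt 2)^-1 < kappa ->
        let E := greedy_ratios (fun I : instance R => rho I <= kappa) in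
        ~ E (inf E)].
Proof.
have k2 : 0 < kappa ^+ 2 by rewrite exprn_gt0.
have kk : kappa ^- 2 * kappa ^+ 2 = 1 by rewrite mulVf // gt_eqF.
have c0 : 0 < kappa ^- 2 - 1.
  by rewrite subr_gt0 invf_gt1 // expr_lt1 // ltW.
have s0 : 0 < (Num.sqrt 2)^-1 :> R by rewrite invr_gt0 sqrtr_gt0.
have s2 : (Num.sqrt 2)^-1 ^+ 2 = 2^-1 :> R by rewrite exprVn sqr_sqrtr.
have c1 : (Num.sqrt 2)^-1 < kappa -> kappa ^- 2 - 1 < 1 by move=> sk; nra.
have ck : (kappa ^- 2 - 1) * kappa ^+ 2 <= 1 - kappa ^+ 2.
  by rewrite mulrBl kk mul1r.
split=> [I le_rho G out|k_le I le_rho S|sk|sk E].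
- apply: (greedy_ratio_ge kappa_gt0 kappa_lt1 le_rho _ _ out).
    by rewrite lt_min ltr01 c0 ge_min lexx.
  apply: le_trans ck; rewrite ler_pM2r //.
  by rewrite /cconst ge_min lexx orbT.
- have ck1 : 1 * kappa ^+ 2 <= 1 - kappa ^+ 2 by nra.
  have c01 : 0 < (1 : R) <= 1 by rewrite ltr01 lexx.
  have [G out] := greedy_outcome_exists I.
  have tail := tail_le_outer kappa_lt1 le_rho.
  rewrite -(greedy_lexmax tail out).
  have optG : area G = A_opt I.
    apply/eqP; rewrite eq_le (area_le_A_opt (greedy_feasible out)) /=.
    by have := greedy_ratio_ge kappa_gt0 kappa_lt1 le_rho c01 ck1 out; rewrite mul1r.
  split=> [[feas optS]|]; last by move=> ->; split=> //; exact: (greedy_feasible out).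
  have [//|/eqP SG] := eqVneq S G.
  have := greedy_area_gt kappa_gt0 kappa_lt1 le_rho c01 ck1 out feas SG.
  by rewrite mul1r optS optG ltxx.
- set T := greedy_ratios _.
  have lbT : lbound T (kappa ^- 2 - 1).
    move=> _ [I [G [[_ _ le_rho] opt0 out ->]]]; rewrite ler_pdivlMr //.
    apply: (greedy_ratio_ge kappa_gt0 kappa_lt1 le_rho _ ck out).
    by rewrite c0 ltW // c1.
  have k01 : 0 < kappa < 1 by rewrite kappa_gt0.
  apply/eqP; rewrite eq_le; apply/andP; split.
    rewrite leNgt; apply/negP => /(greedy_ratios_lt k01)[y Ty].
    by rewrite ltNge (ge_inf _ Ty) //; exists (kappa ^- 2 - 1).
  apply: lb_le_inf => //.
  have [|y Ty _] := greedy_ratios_lt k01 (x := kappa ^- 2); last by exists y.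
  by rewrite ltrBlDr ltrDl.
- move=> [I [G [le_rho opt0 out infE]]].
  have k01 : 0 < kappa < 1 by rewrite kappa_gt0.
  have c01 : 0 < kappa ^- 2 - 1 < 1 by rewrite c0 c1.
  have := greedy_ratio_gt kappa_gt0 kappa_lt1 le_rho c01 ck out opt0.
  rewrite -ltr_pdivlMr // -infE => /(greedy_ratios_lt k01)[y].
  move=> [J [H [[_ _ J_rho] J_opt J_out ->]]].
  rewrite ltNge ge_inf //; last by exists J, H.
  exists 0 => _ [I' [G' [_ opt' _ ->]]].
  by rewrite divr_ge0 ?area_ge0 // ltW.
Qed.
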